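(* For any function $f\colon\mathbb N\to\mathbb N$, the set of finite monoids admitting an $O(f(n))$ space algorithm for out-of-order evaluation forms a monoid variety, i.e., it is closed under direct product, sub-monoid, and monoid quotient.
   Context: All monoids are finite. A sub-monoid of $M$ is a subset closed under the composition law and containing the neutral element of $M$ (as its neutral element). A monoid quotient of $M$ is the quotient $M/{\sim}$ by a congruence $\sim$ on $M$, i.e., an equivalence relation such that $s\sim t$ and $s'\sim t'$ imply $ss'\sim tt'$. Problem. Let $w=w[1]\cdots w[n]$ be a word of length $n>0$ over a fixed monoid $M$ and let $\pi$ be a permutation of $\{1,\ldots,n\}$. The out-of-order stream of $w$ defined by $\pi$ is the sequence of triples $(w[\pi(i)],\pi(i),n)$ for $i=1,\ldots,n$. In the out-of-order evaluation problem for $M$, the algorithm receives the triples one after the other, for arbitrary $w$ and arbitrary $\pi$, and must output at the end the product $w[1]\cdot\cdots\cdot w[n]$ in $M$. The length $n$ is known and not counted in the space. Space. Algorithms are deterministic, and only the bits memorized between two consecutive stream elements are counted (computation time and interim memory used while processing an element are ignored). Formally, an algorithm using $s(n)$ bits consists, for each $n\ge 1$, of a set $Q_n$ of memory states with $|Q_n|\le 2^{s(n)}$, an initial state, an update function $Q_n\times M\times\{1,\ldots,n\}\to Q_n$, and an output function $Q_n\to M$, such that for every $w\in M^n$ and every permutation $\pi$ the output after processing the stream is the product of $w$. It is an $O(f(n))$ space algorithm if $s(n)=O(f(n))$. *)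

(* Defs.v *)
From HB Require Import structures.
From mathcomp Require Import all_boot generic_quotient.

Set Implicit Arguments.
Unset Strict Implicit.
Unset Printing Implicit Defensive.

(* Hierarchy Builder rejects this structure once [fingroup] is loaded, since  *)
(* finite monoids would then be declared after finite groups. Hence           *)
(* permutations below are bijections of ['I_n] and not elements of ['S_n].    *)
#[short(type="finMonoidType")]
HB.structure Definition FinMonoid := {M of Monoid M & Finite M}.
Bind Scope group_scope with FinMonoid.sort.

HB.instance Definition _ (M N : finMonoidType) := Finite.on (M * N)%type.

Section SubMonoid.
Variables (M : finMonoidType) (A : {set M}).

Definition submonoid of monoid_closed A := {x : M | x \in A}.

Variable clA : monoid_closed A.
HB.instance Definition _ := SubType.on (submonoid clA).
HB.instance Definition _ := Finite.on (submonoid clA).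
HB.instance Definition _ :=
  SubChoice_isSubMonoid.Build M [in A] (submonoid clA) clA.

End SubMonoid.

Section Quotient.
Local Open Scope group_scope.
Local Open Scope quotient_scope.

Record congruence (M : finMonoidType) (e : rel M) : Prop := Congruence {
  congr_refl : reflexive e;
  congr_sym : symmetric e;
  congr_trans : transitive e;
  congr_mul : forall s t s' t' : M, e s t -> e s' t' -> e (s * s') (t * t')
}.

Variables (M : finMonoidType) (e : rel M) (ce : congruence e).

Definition congr_equiv : equiv_rel M :=
  EquivRel e (congr_refl ce) (congr_sym ce) (congr_trans ce).

Definition monoid_quot := {eq_quot congr_equiv}.

HB.instance Definition _ := EqQuotient.on monoid_quot.
HB.instance Definition _ := Choice.on monoid_quot.
HB.instance Definition _ := Choice_isCountable.Build monoid_quot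
  (pcan_pickleK (can_pcan (@reprK M monoid_quot))).
HB.instance Definition _ := isFinite.Build monoid_quot
  (pcan_enumP (can_pcan (@reprK M monoid_quot))).

Definition quot_mul := lift_op2 monoid_quot *%g.
Definition quot_one := lift_cst monoid_quot 1.

Lemma pi_mul : {morph \pi_monoid_quot : x y / x * y >-> quot_mul x y}.
Proof.
move=> x y; unlock quot_mul; apply/eqmodP.
by apply: (congr_mul ce); rewrite -[e _ _]/(congr_equiv _ _) -eqmodE reprK.
Qed.

Lemma pi_one : \pi_monoid_quot 1 = quot_one.
Proof. by unlock quot_one. Qed.

Lemma quot_mulA : associative quot_mul.
Proof.
by move=> x y z; rewrite -[x]reprK -[y]reprK -[z]reprK -!pi_mul mulgA.
Qed.

Lemma quot_mul1 : left_id quot_one quot_mul.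
Proof. by move=> x; rewrite -[x]reprK -pi_one -pi_mul mul1g. Qed.

Lemma quot_mulr1 : right_id quot_one quot_mul.
Proof. by move=> x; rewrite -[x]reprK -pi_one -pi_mul mulg1. Qed.

HB.instance Definition _ :=
  isMonoid.Build monoid_quot quot_mulA quot_mul1 quot_mulr1.

End Quotient.

Record monoid_variety (C : finMonoidType -> Prop) : Prop := MonoidVariety {
  variety_prod : forall M N : finMonoidType, C M -> C N -> C (M * N)%type;
  variety_sub : forall (M : finMonoidType) (A : {set M})
    (clA : monoid_closed A), C M -> C (submonoid clA);
  variety_quot : forall (M : finMonoidType) (e : rel M) (ce : congruence e),
    C M -> C (monoid_quot ce)
}.

(* Positions 1, ..., n are represented by ['I_n]. The third component n of    *)
(* the stream elements is omitted: the update function is already indexed by  *)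
(* the length n. The components at n = 0 are never constrained.               *)
Record ooo_algorithm (M : finMonoidType) := OooAlgorithm {
  state : nat -> finType;
  init : forall n, state n;
  update : forall n, state n -> M -> 'I_n -> state n;
  output : forall n, state n -> M
}.

Definition ooo_stream (T : Type) (n : nat) (w : n.-tuple T)
    (p : 'I_n -> 'I_n) : seq (T * 'I_n) :=
  [seq (tnth w (p i), p i) | i <- enum 'I_n].

Definition ooo_run (M : finMonoidType) (a : ooo_algorithm M) (n : nat)
    (st : seq (M * 'I_n)) : M :=
  output (foldl (fun q x => update q x.1 x.2) (init a n) st).

Definition ooo_evaluates (M : finMonoidType) (a : ooo_algorithm M) : Prop :=
  forall n, 0 < n -> forall (w : n.-tuple M) (p : 'I_n -> 'I_n),
    bijective p -> ooo_run a (ooo_stream w p) = (\prod_(i < n) tnth w i)%g.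

Definition ooo_uses_space (M : finMonoidType) (a : ooo_algorithm M)
    (s : nat -> nat) : Prop :=
  forall n, 0 < n -> #|state a n| <= 2 ^ s n.

Definition bigO (f s : nat -> nat) : Prop :=
  exists c n0 : nat, forall n, n0 <= n -> s n <= c * f n.

Definition ooo_space_class (f : nat -> nat) (M : finMonoidType) : Prop :=
  exists (s : nat -> nat) (a : ooo_algorithm M),
    [/\ bigO f s, ooo_evaluates a & ooo_uses_space a s].

(* Main.v *)
Require Import Defs.
From mathcomp Require Import all_boot.

(** The permutation only governs the order in which letters arrive, so translating letters commutes
    with forming the stream. Sub-monoids and quotients are both handled by [ooo_space_class_decode]:
    encode each letter into [M] on arrival, run the algorithm for [M] with its memory unchanged,
    decode only the final product. For a direct product, the two algorithms run in parallel on the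
    projections of the stream ([foldl_pair]); their bits add up, which [bigO_add] absorbs. *)

Lemma foldl_map (T T' R : Type) (h : T -> T') (f : R -> T' -> R) (z : R)
    (s : seq T) :
  foldl f z (map h s) = foldl (fun r x => f r (h x)) z s.
Proof. by elim: s z => //= x s IHs z. Qed.

Lemma foldl_pair (R S T : Type) (f : R -> T -> R) (g : S -> T -> S) (q : R * S)
    (s : seq T) :
  foldl (fun q x => (f q.1 x, g q.2 x)) q s = (foldl f q.1 s, foldl g q.2 s).
Proof. by elim: s q => [[]|x s IHs] //= q; rewrite IHs. Qed.

Lemma bigO_add (f s t : nat -> nat) :
  bigO f s -> bigO f t -> bigO f (fun n => s n + t n).
Proof.
move=> [c [n0 s_le]] [d [m0 t_le]]; exists (c + d), (maxn n0 m0) => n.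
by rewrite geq_max => /andP[/s_le s_n /t_le t_n]; rewrite mulnDl leq_add.
Qed.

Lemma ooo_stream_map (T T' : Type) (h : T -> T') (n : nat) (w : n.-tuple T)
    (p : 'I_n -> 'I_n) :
  ooo_stream (map_tuple h w) p = [seq (h x.1, x.2) | x <- ooo_stream w p].
Proof.
by rewrite /ooo_stream -map_comp; apply: eq_map => i /=; rewrite tnth_map.
Qed.

(** Neither map has to be a morphism: [dec] only needs to be right on products of encoded letters.
    This covers inclusions, where [enc] is a morphism, as well as quotients, where [dec] is one. *)
Lemma ooo_space_class_decode (f : nat -> nat) (M N : finMonoidType)
    (enc : N -> M) (dec : M -> N) :
  (forall n (w : 'I_n -> N),
     dec (\prod_(i < n) enc (w i))%g = (\prod_(i < n) w i)%g) ->
  ooo_space_class f M -> ooo_space_class f N.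
Proof.
move=> decK [s [a [Os a_eval a_space]]].
pose b := @OooAlgorithm N (state a) (init a)
  (fun n q x i => update q (enc x) i) (fun n q => dec (output q)).
exists s, b; split=> // n n_gt0 w p bij_p.
have := a_eval n n_gt0 (map_tuple enc w) p bij_p.
rewrite /ooo_run ooo_stream_map foldl_map /= => ->.
by rewrite -decK; congr dec; apply: eq_bigr => i _; rewrite tnth_map.
Qed.

Lemma ooo_space_class_prod (f : nat -> nat) (M N : finMonoidType) :
  ooo_space_class f M -> ooo_space_class f N -> ooo_space_class f (M * N)%type.
Proof.
move=> [s [a [Os a_eval a_space]]] [t [b [Ot b_eval b_space]]].
pose c := @OooAlgorithm (M * N)%type (fun n => (state a n * state b n)%type)
  (fun n => (init a n, init b n))
  (fun n q x i => (update q.1 x.1 i, update q.2 x.2 i))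
  (fun n q => (output q.1, output q.2)).
exists (fun n => s n + t n), c; split; first exact: bigO_add.
- move=> n n_gt0 w p bij_p.
  have := b_eval n n_gt0 (map_tuple snd w) p bij_p.
  have := a_eval n n_gt0 (map_tuple fst w) p bij_p.
  rewrite /ooo_run !ooo_stream_map !foldl_map /= => a_w b_w.
  rewrite (foldl_pair _ _ _ (fun q i => update q (tnth w (p i)).1 (p i))
    (fun q i => update q (tnth w (p i)).2 (p i))) /= a_w b_w.
  rewrite [RHS]surjective_pairing.
  rewrite (big_morph fst (id1 := 1%g) (op1 := *%g)) //.
  rewrite (big_morph snd (id1 := 1%g) (op1 := *%g)) //.
  by congr pair; apply: eq_bigr => i _; rewrite tnth_map.
(* A memory state is a pair, so the state counts multiply and the exponents add. *)
- by move=> n n_gt0; rewrite card_prod expnD leq_mul ?a_space ?b_space.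
Qed.

Theorem proposition3p1 (f : nat -> nat) : monoid_variety (ooo_space_class f).
Proof.
split=> [M N | M A clA | M e ce].
- exact: ooo_space_class_prod.
(* The default [1] of [insubd] is never reached: a product of elements of [A] stays in [A]. *)
- apply: (ooo_space_class_decode f M (submonoid clA) val (insubd 1%g)) => n w.
  by rewrite -(big_morph val (id1 := 1%g) (op1 := *%g)
    (id2 := 1%g) (op2 := *%g)) ?valKd.
(* Any choice of representatives works, since the projection is a morphism and sends each
   representative back to its class. *)
- apply: (ooo_space_class_decode f M (monoid_quot ce) repr
    \pi_(monoid_quot ce)%qT) => n w.
  rewrite (big_morph _ (pi_mul ce) (pi_one ce)).
  by apply: eq_bigr => i _; rewrite reprK.
Qed.
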